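(* Let $a,b\in\mathbb{Z}_{\geq 0}$, let $n\geq 2$ be an integer, and let $\beta$ be a root of the polynomial $ax^{2n}+bx^n-1$ with $0<\beta<1$. Then the algebraic Bieri-Strebel group $G([0,1],\mathbb{Z}[\beta],\langle\beta\rangle)$ cannot have a (well-defined) tree-pair representation based on its subdivision polynomial $ax^{2n}+bx^n-1$.
   Context: Bieri-Strebel groups: for a real number $\beta>0$, $\langle\beta\rangle=\{\beta^k : k\in\mathbb{Z}\}$ is the multiplicative group generated by $\beta$, and $\mathbb{Z}[\beta]$ is the subring of $\mathbb{R}$ generated by $\beta$. The group $G([0,1],\mathbb{Z}[\beta],\langle\beta\rangle)$ is the group, under composition, of piecewise-linear orientation-preserving homeomorphisms of $[0,1]$ with finitely many breakpoints, all breakpoints lying in $[0,1]\cap\mathbb{Z}[\beta]$, and all slopes lying in $\langle\beta\rangle$. Subdivision polynomials and carets: a subdivision polynomial is a polynomial $P(x)=a_mx^m+\dots+a_1x-1$ with all $a_i\in\mathbb{Z}_{\geq 0}$. Suppose $\beta>0$ satisfies $P(\beta)=0$, i.e. $\sum_i a_i\beta^i=1$. A caret for $P$ is a root with $\sum_i a_i$ legs, ordered from left to right, each leg having a length in $\{1,\dots,m\}$, exactly $a_i$ of them having length $i$; different left-to-right orderings of the leg lengths give different caret types, and all are allowed. A tree for $P$ is a finite rooted ordered tree obtained from a single root vertex by finitely many times attaching a caret (of any type) to a leaf. The depth of a node is the sum of the lengths of the legs on the path from the root to it. Each node represents a subinterval of $[0,1]$: the root represents $[0,1]$, and if a node represents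 an interval of length $\beta^d$ and carries a caret with leg lengths $l_1,l_2,\dots$ from left to right, its children represent, from left to right, the consecutive subintervals of lengths $\beta^{d+l_1},\beta^{d+l_2},\dots$ into which it is subdivided. Thus a node of depth $d$ represents an interval of length $\beta^d$. Tree-pair representation: a tree pair for $P$ is a pair $(T_1,T_2)$ of trees for $P$ with the same number of leaves; it represents the element of $G([0,1],\mathbb{Z}[\beta],\langle\beta\rangle)$ mapping, for each $i$, the interval of the $i$th leaf of $T_1$ (counting left to right) linearly and increasingly onto the interval of the $i$th leaf of $T_2$. Tree pairs are considered equivalent if they are related by a finite sequence of moves of the following kinds: adding carets of the same type to corresponding leaves of both trees, removing such a pair of carets, or replacing a subtree of one of the trees by an equivalent one (one with the same sequence of leaf depths from left to right). The group has a well-defined tree-pair representation based on $P$ if every element of the group is represented by exactly one equivalence class of tree pairs for $P$ (in particular, every element is represented by some tree pair). The phrase ''has a tree-pair representation'' means this, with $P$ the subdivision polynomial associated with the group. *)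

(* Defs.v *)
From mathcomp Require Import all_boot all_order all_algebra.
From mathcomp Require Import all_classical all_reals all_analysis.
From Stdlib Require Export Relation_Operators.
Set Implicit Arguments.
Unset Strict Implicit.
Unset Printing Implicit Defensive.
Import Order.TTheory GRing.Theory Num.Theory numFieldNormedType.Exports.
Local Open Scope classical_set_scope.
Local Open Scope ring_scope.

Definition powers (R : realType) (beta : R) : set R :=
  [set beta ^ k | k in [set: int]].

(* Z[beta], as the smallest subring containing beta *)
Definition Zadjoin (R : realType) (beta : R) : set R :=
  [set x | forall S : {pred R},
     GRing.subring_closed S -> beta \in S -> x \in S].

Definition homeomorphism_of (T : topologicalType) (A : set T) (f : T -> T) :=
  exists g : T -> T,
    [/\ set_fun A A f, set_fun A A g,
        {in A, cancel f g} /\ {in A, cancel g f},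
        {within A, continuous f} & {within A, continuous g}].

(* The points of 0 :: rcons s 1 cut [0, 1] into finitely many intervals on
   which f is affine with slope in L; every breakpoint of f is in s, which is
   contained in A. *)
Definition piecewise_linear (R : realType) (A L : set R) (f : R -> R) :=
  exists s : seq R,
    let xs := 0 :: rcons s 1 in
    [/\ sorted <%R xs,
        forall x, x \in s -> A x &
        forall i : nat, (i.+1 < size xs)%N ->
          exists2 c : R, L c &
            forall z, xs`_i <= z <= xs`_i.+1 ->
              f z = f xs`_i + c * (z - xs`_i)].

(* G([0,1], A, L).  A map of [0, 1] is encoded by its extension to R by the
   identity, so that equality of functions is equality in the group and
   composition of functions is the group law. *)
Definition bieri_strebel (R : realType) (A L : set R) : set (R -> R) :=
  [set f | [/\ homeomorphism_of (`[0, 1]%classic : set R) f,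
               {in (`[0, 1]%classic : set R) &, {homo f : x y / x < y}},
               piecewise_linear A L f &
               forall x, ~~ (0 <= x <= 1) -> f x = x]].

(* A caret type is the left-to-right sequence of its leg lengths. *)
Definition is_caret (P : {poly int}) (c : seq nat) :=
  (forall l, l \in c -> (0 < l < size P)%N) /\
  (forall i, (0 < i < size P)%N -> (count_mem i c)%:Z = P`_i).

(* A child comes with the length of the leg leading to it. *)
Inductive tree := Leaf | Node of seq (nat * tree).

Fixpoint leaf_depths (t : tree) : seq nat :=
  if t is Node ch
  then flatten [seq [seq (lu.1 + d)%N | d <- leaf_depths lu.2] | lu <- ch]
  else [:: 0%N].

Definition nleaves (t : tree) : nat := size (leaf_depths t).

(* graft t i s replaces the i-th leaf of t (from the left, starting at 0)
   by the tree s. *)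
Fixpoint graft (t : tree) (i : nat) (s : tree) {struct t} : tree :=
  match t with
  | Leaf => if i == 0%N then s else Leaf
  | Node ch =>
      Node ((fix graft_children (ch : seq (nat * tree)) (i : nat) :=
               match ch with
               | [::] => [::]
               | (l, u) :: ch' =>
                   if (i < nleaves u)%N then (l, graft u i s) :: ch'
                   else (l, u) :: graft_children ch' (i - nleaves u)%N
               end) ch i)
  end.

Definition caret_tree (c : seq nat) : tree := Node [seq (l, Leaf) | l <- c].

Inductive tree_for (P : {poly int}) : tree -> Prop :=
| tree_for_root : tree_for P Leaf
| tree_for_attach t i c :
    tree_for P t -> (i < nleaves t)%N -> is_caret P c ->
    tree_for P (graft t i (caret_tree c)).

(* End points of the intervals represented by the leaves of t, from left to
   right, when the root of t has depth d and represents [x, x + beta ^+ d]. *)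
Fixpoint leaf_itvs (R : realType) (beta x : R) (d : nat) (t : tree) {struct t}
    : seq (R * R) :=
  match t with
  | Leaf => [:: (x, x + beta ^+ d)]
  | Node ch =>
      (fix children_itvs (x : R) (ch : seq (nat * tree)) {struct ch} :=
         match ch with
         | [::] => [::]
         | (l, u) :: ch' =>
             leaf_itvs beta x (d + l)%N u
               ++ children_itvs (x + beta ^+ (d + l)%N) ch'
         end) x ch
  end.

Record tree_pair (P : {poly int}) := TreePair {
  tp1 : tree;
  tp2 : tree;
  tp1_for : tree_for P tp1;
  tp2_for : tree_for P tp2;
  tp_nleaves : nleaves tp1 = nleaves tp2 }.

Definition represents (R : realType) (beta : R) (P : {poly int})
    (p : tree_pair P) (f : R -> R) :=
  forall i, (i < nleaves (tp1 p))%N ->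
    let I := nth (0, 0) (leaf_itvs beta 0 0 (tp1 p)) i in
    let J := nth (0, 0) (leaf_itvs beta 0 0 (tp2 p)) i in
    forall t, 0 <= t <= 1 ->
      f (line_path I.1 I.2 t) = line_path J.1 J.2 t.

Definition add_carets (P : {poly int}) (p q : tree_pair P) :=
  exists i c, [/\ (i < nleaves (tp1 p))%N, is_caret P c,
    tp1 q = graft (tp1 p) i (caret_tree c) &
    tp2 q = graft (tp2 p) i (caret_tree c)].

Definition replace_subtree (T T' : tree) :=
  exists t i s s', [/\ (i < nleaves t)%N, leaf_depths s = leaf_depths s',
    T = graft t i s & T' = graft t i s'].

Inductive move (P : {poly int}) (p q : tree_pair P) : Prop :=
| move_add of add_carets p q
| move_remove of add_carets q p
| move_replace1 of replace_subtree (tp1 p) (tp1 q) & tp2 p = tp2 q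
| move_replace2 of tp1 p = tp1 q & replace_subtree (tp2 p) (tp2 q).

Definition tree_pair_equiv (P : {poly int}) : tree_pair P -> tree_pair P -> Prop :=
  clos_refl_trans (tree_pair P) (@move P).

Definition equiv_class (P : {poly int}) (C : set (tree_pair P)) :=
  exists p, C = [set q | tree_pair_equiv p q].

Definition has_tree_pair_representation (R : realType) (beta : R)
    (P : {poly int}) (G : set (R -> R)) :=
  forall f, G f -> exists! C : set (tree_pair P),
    equiv_class C /\ exists2 p, C p & represents beta p f.

(* Main.v *)
Require Import Defs.
From mathcomp Require Import all_boot all_order all_algebra.
From mathcomp Require Import all_classical all_reals all_analysis.
From mathcomp Require Import ring lra.
Import Order.TTheory GRing.Theory Num.Theory numFieldNormedType.Exports.
Local Open Scope classical_set_scope.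
Local Open Scope ring_scope.

(** Every leg of a caret for [a x^(2n) + b x^n - 1] has length [n] or [2n], so
    all leaves of all trees have depth divisible by [n], and the slopes of an
    element that has a tree pair are powers of [beta ^ n]. The group, however,
    contains elements with slope [beta], for instance the map [bump beta] which
    has slope [beta] on [0, 1 - beta], slope [1 / beta] on the interval of
    length [beta (1 - beta)] that follows, and is the identity beyond the point
    [1 - beta ^ 2] where that interval ends: the first two pieces exchange the
    lengths [1 - beta] and [beta (1 - beta)], so the graph comes back to the
    diagonal there. Since [n >= 2], the slope [beta] is not a power of
    [beta ^ n], and [bump beta] has no tree pair at all.

    It is enough to look at the leftmost leaves, that is, at the slope at 0: if
    they have depths [k1] and [k2] in the two trees, the represented map has
    slope [beta ^ (k2 - k1)] at 0 ([represents_near0]), while [n] divides both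
    depths ([tree_for_leftmost]). *)

(** * The leftmost leaf of a tree *)

(** A relation rather than [head 0 (leaf_depths t)]: a tree may contain nodes
    without children and then have no leaf, and induction on this relation
    follows the leftmost branch only, with no nested recursion on the
    children. *)
Inductive leftmost : nat -> tree -> Prop :=
| leftmost_leaf : leftmost 0 Leaf
| leftmost_node l u ch k :
    leftmost k u -> leftmost (l + k) (Node ((l, u) :: ch)).

Lemma leftmost_nleaves {k t} : leftmost k t -> (0 < nleaves t)%N.
Proof.
elim=> // l u ch k' _; rewrite /nleaves /= size_cat size_map.
exact: ltn_addr.
Qed.

Lemma leftmost_itv {R : realType} (beta : R) {k t} : leftmost k t ->
  forall x d, nth (0, 0) (leaf_itvs beta x d t) 0 = (x, x + beta ^+ (d + k)).
Proof.
move=> tk; suff H x d : exists s,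
    leaf_itvs beta x d t = (x, x + beta ^+ (d + k)) :: s.
  by move=> x d; have [s ->] := H x d.
elim: tk x d => [x d|l u ch k' _ IH x d]; first by exists [::]; rewrite addn0.
by have [s us] := IH x (d + l)%N; rewrite /= us /= addnA; eexists.
Qed.

(** Only a caret attached to the leftmost leaf itself moves the new leftmost
    leaf, down along the first leg of that caret. *)
Lemma leftmost_graft {k t} i l c : leftmost k t ->
  leftmost k (graft t i (caret_tree (l :: c))) \/
  leftmost (k + l) (graft t i (caret_tree (l :: c))).
Proof.
move=> tk; elim: tk i => [|l' u ch k' uk' IH] i /=.
  case: (i == 0%N); [right|by left; constructor].
  by rewrite add0n -[X in leftmost X]addn0; do 2!constructor.
case: ifP => _; last by left; constructor.
by case: (IH i) => ?; [left|right; rewrite -addnA]; constructor.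
Qed.

(** The second hypothesis makes carets nonempty, so that a leftmost leaf always
    exists. *)
Lemma tree_for_leftmost {P : {poly int}} {g t} :
  (forall i, (0 < i)%N -> P`_i != 0 -> (g %| i)%N) ->
  (exists2 i, (0 < i)%N & P`_i != 0) ->
  tree_for P t -> exists2 k, leftmost k t & (g %| k)%N.
Proof.
move=> Pg [j j0 Pj]; elim=> [|{}t i c _ [k tk gk] _ [c_legs c_count]].
  by exists 0%N => //; constructor.
have jP : (j < size P)%N.
  by rewrite ltnNge; apply: contra Pj => /(nth_default 0) ->.
case: c => [|l c] in c_legs c_count *.
  by move: Pj; rewrite -c_count ?j0.
have /c_legs /andP[l0 lP] : l \in l :: c by rewrite mem_head.
have gl : (g %| l)%N by apply: Pg; rewrite // -c_count ?l0 //= eqxx.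
case: (leftmost_graft i l c tk) => ?; first by exists k.
by exists (k + l)%N; rewrite ?dvdn_add.
Qed.

Lemma represents_near0 {R : realType} {beta : R} {P : {poly int}}
    {p : tree_pair P} {f : R -> R} {k1 k2} :
  leftmost k1 (tp1 p) -> leftmost k2 (tp2 p) -> represents beta p f ->
  forall t, 0 <= t <= 1 -> f (t * beta ^+ k1) = t * beta ^+ k2.
Proof.
move=> lm1 lm2 /(_ 0%N (leftmost_nleaves lm1)) + t /[dup] t01.
rewrite (leftmost_itv _ lm1) (leftmost_itv _ lm2) /=.
by move=> /(_ t) /[apply]; rewrite /line_path !add0n !add0r !mulr0 !add0r.
Qed.

(** * An element of the group with slope beta at 0 *)

(** Written with [min] and [max], the map is visibly continuous and increasing,
    and it is the identity outside [0, 1 - beta ^ 2] without further cases. *)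
Definition bump {R : realType} (beta x : R) : R :=
  Num.min x (Num.max (beta * x)
    (1 - beta ^+ 2 + (x - (1 - beta ^+ 2)) / beta)).

(** The reflection of [0, 1 - beta ^ 2] exchanges the pieces of slope [beta]
    and [1 / beta], and so conjugates [bump beta] to its inverse. *)
Definition bump_inv {R : realType} (beta y : R) : R :=
  1 - beta ^+ 2 - bump beta (1 - beta ^+ 2 - y).

Section Bump.
Context {R : realType} {beta : R}.
Hypothesis beta01 : 0 < beta < 1.

Lemma bump_id {x} : x <= 0 \/ 1 - beta ^+ 2 <= x -> bump beta x = x.
Proof.
have /andP[beta_gt0 beta_lt1] := beta01.
move=> x_out; rewrite /bump; apply/min_idPl; rewrite le_max.
case: x_out => hx.
  by apply/orP; left; nra.
by apply/orP; right; rewrite -lerBlDl ler_pdivlMr //; nra.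
Qed.

Lemma bump_left {x} : 0 <= x <= 1 - beta -> bump beta x = beta * x.
Proof.
have /andP[beta_gt0 beta_lt1] := beta01.
have q_gt0 : 0 < 1 - beta ^+ 2 by nra.
case/andP=> x0 xu; rewrite /bump max_l.
  by rewrite min_r //; nra.
by rewrite -lerBrDl ler_pdivrMr //; nra.
Qed.

Lemma bump_right {x} : 1 - beta <= x <= 1 - beta ^+ 2 ->
  bump beta x = 1 - beta ^+ 2 + (x - (1 - beta ^+ 2)) / beta.
Proof.
have /andP[beta_gt0 beta_lt1] := beta01.
have q_gt0 : 0 < 1 - beta ^+ 2 by nra.
case/andP=> ux xq; rewrite /bump max_r.
  by rewrite min_r // -lerBrDl ler_pdivrMr //; nra.
by rewrite -lerBlDl ler_pdivlMr //; nra.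
Qed.

Lemma bump_homo : {homo bump beta : x y / x < y}.
Proof.
have /andP[beta_gt0 _] := beta01.
move=> x y xy; rewrite /bump.
have h1 : beta * x < beta * y by rewrite ltr_pM2l.
have h2 : (x - (1 - beta ^+ 2)) / beta < (y - (1 - beta ^+ 2)) / beta.
  by rewrite ltr_pM2r ?invr_gt0 // ltrD2r.
by rewrite lt_min !gt_min xy /= gt_max !lt_max h1 ltrD2l h2 !orbT.
Qed.

Lemma continuous_bump : continuous (bump beta).
Proof.
move=> x; apply: (@continuous_min R R id) => //.
apply: (@continuous_max R R ( *%R beta)); first exact: mulrl_continuous.
apply: cvgD; first exact: cvg_cst.
by apply: cvgMl; apply: cvgB; [exact: cvg_id|exact: cvg_cst].
Qed.

Lemma bumpK : cancel (bump beta) (bump_inv beta).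
Proof.
have /andP[beta_gt0 beta_lt1] := beta01.
move=> x; rewrite /bump_inv.
have b0 : beta != 0 by rewrite gt_eqF.
have [x0|x0] := leP x 0.
  by rewrite (bump_id (or_introl x0)) bump_id; [ring|right; lra].
have [xu|ux] := leP x (1 - beta).
  rewrite (@bump_left x) ?(ltW x0) ?xu // bump_right; first by field.
  by apply/andP; split; nra.
have [qx|xq] := leP (1 - beta ^+ 2) x.
  by rewrite (bump_id (or_intror qx)) bump_id; [ring|left; lra].
rewrite (@bump_right x) ?(ltW ux) ?(ltW xq) // bump_left; first by field.
rewrite opprD addNKr -mulNr opprB.
rewrite divr_ge0 ?subr_ge0 ?(ltW xq) ?(ltW beta_gt0) //=.
by rewrite ler_pdivrMr //; nra.
Qed.

Lemma bump_invK : cancel (bump_inv beta) (bump beta).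
Proof.
move=> y; have := bumpK (1 - beta ^+ 2 - y); rewrite {1}/bump_inv.
by move/addrI/oppr_inj.
Qed.

Lemma bump_unit x : (0 <= bump beta x <= 1) = (0 <= x <= 1).
Proof.
have /andP[beta_gt0 beta_lt1] := beta01.
have f_mono := le_mono bump_homo.
have f0 : bump beta 0 = 0 by rewrite bump_id //; left.
have f1 : bump beta 1 = 1 by rewrite bump_id //; right; nra.
by rewrite -{1}f0 -{1}f1 !f_mono.
Qed.

Lemma Zadjoin_breakpoints :
  Zadjoin beta (1 - beta) /\ Zadjoin beta (1 - beta ^+ 2).
Proof.
by split=> S [S1 SB SM] Sb; apply: (SB) => //; apply: SM.
Qed.

Lemma bump_bieri_strebel :
  bieri_strebel (Zadjoin beta) (powers beta) (bump beta).
Proof.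
have /andP[beta_gt0 beta_lt1] := beta01.
split.
- exists (bump_inv beta); split.
  + by move=> x /=; rewrite !in_itv /= bump_unit.
  + move=> x /=; rewrite !in_itv /=.
    by rewrite -(bump_unit (bump_inv beta x)) bump_invK.
  + by split=> x _; [exact: bumpK|exact: bump_invK].
  + exact: continuous_subspaceT continuous_bump.
  + apply: continuous_subspaceT => x; apply: cvgB; first exact: cvg_cst.
    apply: (@continuous_comp _ _ _ (fun y => 1 - beta ^+ 2 - y));
      last exact: continuous_bump.
    by apply: cvgB; [exact: cvg_cst|exact: cvg_id].
- by move=> x y _ _; exact: bump_homo.
- exists [:: 1 - beta; 1 - beta ^+ 2]; split.
  + by rewrite /= andbT; apply/and3P; split; nra.
  + by have [Z1 Z2] := Zadjoin_breakpoints => x; rewrite !inE => /orP[]/eqP->.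
  + case=> [|[|[|//]]] _ /=.
    * exists beta; first by exists 1; rewrite ?expr1z.
      by move=> z hz; rewrite !bump_left //; [ring|lra].
    * exists beta^-1; first by exists (- 1).
      by move=> z hz; rewrite !bump_right //; [ring|nra].
    * exists 1; first by exists 0; rewrite ?expr0z.
      by move=> z /andP[qz _]; rewrite !bump_id; [ring|right|right].
- by move=> x x_out; apply: bump_id; nra.
Qed.

(** Both leftmost leaves start at 0, so near 0 the map is multiplication by
    [beta ^ (k2 - k1)], and it is also multiplication by [beta]. *)
Lemma represents_bump_depth {P : {poly int}} {p : tree_pair P} {k1 k2} :
  leftmost k1 (tp1 p) -> leftmost k2 (tp2 p) -> represents beta p (bump beta) ->
  k2 = k1.+1.
Proof.
have /andP[beta_gt0 beta_lt1] := beta01.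
move=> lm1 lm2 rep; have k1_gt0 : 0 < beta ^+ k1 by rewrite exprn_gt0.
have k1_le1 : beta ^+ k1 <= 1 by rewrite exprn_ile1 // ltW.
have u_gt0 : 0 < 1 - beta by lra.
(* This parameter keeps the point [t * beta ^ k1] in the piece of slope [beta]
   whatever [k1] is. *)
have := represents_near0 lm1 lm2 rep (1 - beta).
rewrite bump_left; last by apply/andP; split; nra.
rewrite mulrCA -exprS => eq_u.
apply/esym; apply: (ieexprIn beta_gt0 (negbT (lt_eqF beta_lt1))).
by apply: (mulfI (lt0r_neq0 u_gt0)); rewrite eq_u //; lra.
Qed.

End Bump.

Theorem theorem1p1 (R : realType) (a b n : nat) (beta : R) :
  let P : {poly int} := a%:Z *: 'X^(2 * n) + b%:Z *: 'X^n - 1 in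
  (2 <= n)%N ->
  root (map_poly intr P) beta ->
  0 < beta < 1 ->
  ~ has_tree_pair_representation beta P
      (bieri_strebel (Zadjoin beta) (powers beta)).
Proof.
move=> P n2 rootP beta01 /(_ _ (bump_bieri_strebel beta01)).
case=> C [[_ [p _ rep]] _].
have n0 : (0 < n)%N by exact: ltnW.
have coefP i : (0 < i)%N ->
    P`_i = a%:Z * (i == 2 * n)%N%:R + b%:Z * (i == n)%:R.
  by case: i => // i _; rewrite /P coefB coefD !coefZ !coefXn coef1 subr0.
have nP i : (0 < i)%N -> P`_i != 0 -> (n %| i)%N.
  move=> i0; rewrite coefP //.
  have [->|_] := eqVneq i (2 * n)%N; first by rewrite dvdn_mull.
  by have [->|_] := eqVneq i n; rewrite // !mulr0 addr0 eqxx.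
have P_nonconst : exists2 i, (0 < i)%N & P`_i != 0.
  (* Otherwise [a = b = 0] and [P = -1] has no root. *)
  have [a0|a_neq0] := eqVneq a 0%N; last first.
    exists (2 * n)%N; first by rewrite muln_gt0.
    rewrite coefP ?muln_gt0 // eqxx mulr1 gtn_eqF ?mulr0 ?addr0 //.
    by rewrite mul2n -addnn -[ltnLHS]addn0 ltn_add2l.
  exists n; rewrite // coefP // eqxx mulr1 a0 mul0r add0r.
  apply: contraTneq rootP => /= b0; rewrite /P a0 b0 !scale0r !add0r.
  by rewrite rmorphN rmorph1 rootN root1.
have [k1 lm1 nk1] := tree_for_leftmost nP P_nonconst (tp1_for p).
have [k2 lm2 nk2] := tree_for_leftmost nP P_nonconst (tp2_for p).
move: nk2; rewrite (represents_bump_depth beta01 lm1 lm2 rep).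
by rewrite -addn1 dvdn_addr // dvdn1 gtn_eqF.
Qed.
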